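(* Let $\mathbf{X}$ be a category with pullbacks and let $(\mathcal{M},\mathcal{N})$ be a preadhesive structure on $\mathbf{X}$. Suppose that every split monomorphism of $\mathbf{X}$ is in $\mathcal{M}\cap\mathcal{N}$, that every arrow in $\mathcal{M}$ is $\mathcal{N}$-adhesive, and that $\mathcal{M}$ is closed under $\mathcal{M},\mathcal{N}$-unions. Then $\mathbf{X}$ is $\mathcal{M},\mathcal{N}$-adhesive.
   Context: Classes of arrows. A class $\mathcal{A}$ of arrows is stable under pullbacks (resp. pushouts) if for every pullback (resp. pushout) square with $f:A\to B$, $m:A\to C$, $n:B\to D$, $g:C\to D$, $n\circ f=g\circ m$, $n\in\mathcal{A}$ implies $m\in\mathcal{A}$ (resp. $m\in\mathcal{A}$ implies $n\in\mathcal{A}$); existence of the (co)limits is not assumed. $\mathcal{A}$ is closed under $\mathcal{B}$-decomposition if $g\circ f\in\mathcal{A}$ and $g\in\mathcal{B}$ imply $f\in\mathcal{A}$; closed under decomposition means closed under $\mathcal{A}$-decomposition. Preadhesive structure. A pair $(\mathcal{M},\mathcal{N})$ with $\mathcal{M}$ a class of monomorphisms and $\mathcal{N}$ a class of arrows of $\mathbf{X}$ such that: (1) $\mathcal{M}$ and $\mathcal{N}$ contain all isomorphisms and are closed under composition and decomposition; (2) $\mathcal{N}$ is closed under $\mathcal{M}$-decomposition; (3) $\mathcal{M}$ and $\mathcal{N}$ are stable under pullbacks and pushouts. Stable and Van Kampen squares. A pushout square $g:A\to B$, $m:A\to C$, $n:B\to D$, $f:C\to D$ is Van Kampen if for every commutative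 cube having it as bottom face, with top face $g':A'\to B'$, $m':A'\to C'$, $n':B'\to D'$, $f':C'\to D'$ and vertical arrows $a:A'\to A$, $b:B'\to B$, $c:C'\to C$, $d:D'\to D$, such that the two vertical faces containing $a$ are pullbacks, the top face is a pushout if and only if the two vertical faces containing $d$ are pullbacks. It is stable if the ''if'' half holds (the two faces containing $d$ being pullbacks implies the top face is a pushout). $\mathcal{M},\mathcal{N}$-adhesivity. $\mathbf{X}$ is $\mathcal{M},\mathcal{N}$-adhesive if $(\mathcal{M},\mathcal{N})$ is a preadhesive structure and: (1) pullbacks of arrows in $\mathcal{M}$ along arbitrary arrows exist; (2) for $m:X\to Y$ in $\mathcal{M}$ and $n:X\to Z$ in $\mathcal{N}$ a pushout of $m$ and $n$ exists (an $\mathcal{M},\mathcal{N}$-pushout); (3) $\mathcal{M},\mathcal{N}$-pushouts are Van Kampen squares. $\mathcal{N}$-adhesive arrows. An arrow $m:X\to Y$ is $\mathcal{N}$-preadhesive if for every $n:X\to Z$ in $\mathcal{N}$ a stable pushout square of $m$ along $n$ exists and it is also a pullback square. It is $\mathcal{N}$-adhesive if all its pullbacks are $\mathcal{N}$-preadhesive. Unions. $(\mathsf{Sub}(X),\le)$ is the poset of subobjects of $X$ (isomorphism classes $[m]$ of monos into $X$, ordered by factorization). A mono $u:U\to X$ is an $\mathcal{M},\mathcal{N}$-union if there are $m\in\mathcal{M}$ and $n\in\mathcal{M}\cap\mathcal{N}$ with codomain $X$ such that $[u]=[m]\vee[n]$ in $(\mathsf{Sub}(X),\le)$. $\mathcal{M}$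 is closed under $\mathcal{M},\mathcal{N}$-unions if it contains all such monos. A split monomorphism is an arrow having a left inverse. *)

(* Defs.v *)
Set Implicit Arguments.
Unset Strict Implicit.
Unset Printing Implicit Defensive.

Declare Scope cat_scope.
Delimit Scope cat_scope with cat.
Local Open Scope cat_scope.

Record category : Type := Category {
  ob :> Type;
  hom : ob -> ob -> Type;
  idm : forall A : ob, hom A A;
  comp : forall A B C : ob, hom B C -> hom A B -> hom A C;
  comp_assoc : forall (A B C D : ob) (h : hom C D) (g : hom B C) (f : hom A B),
      comp h (comp g f) = comp (comp h g) f;
  comp_idl : forall (A B : ob) (f : hom A B), comp (idm B) f = f;
  comp_idr : forall (A B : ob) (f : hom A B), comp f (idm A) = f
}.

Arguments hom {c} A B.
Arguments idm {c} A.
Arguments comp {c A B C} g f.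

Notation "g ∘ f" := (comp g f) (at level 40, left associativity) : cat_scope.

Definition arrow_class (X : category) : Type :=
  forall A B : X, hom A B -> Prop.

Section Arrows.
Variable X : category.

Definition is_mono (A B : X) (m : hom A B) : Prop :=
  forall (Z : X) (h k : hom Z A), m ∘ h = m ∘ k -> h = k.

Definition is_iso (A B : X) (f : hom A B) : Prop :=
  exists g : hom B A, g ∘ f = idm A /\ f ∘ g = idm B.

Definition is_split_mono (A B : X) (m : hom A B) : Prop :=
  exists r : hom B A, r ∘ m = idm A.

(* A square is always listed as  f m n g , in the layout
<<
        f
     A ---> B
   m |      | n
     v      v
     C ---> D
        g
>>
*)
Definition commutes (A B C D : X)
    (f : hom A B) (m : hom A C) (n : hom B D) (g : hom C D) : Prop :=
  n ∘ f = g ∘ m.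

Definition is_pullback (A B C D : X)
    (f : hom A B) (m : hom A C) (n : hom B D) (g : hom C D) : Prop :=
  commutes f m n g /\
  forall (Z : X) (h : hom Z B) (k : hom Z C), commutes h k n g ->
    exists! u : hom Z A, f ∘ u = h /\ m ∘ u = k.

Definition is_pushout (A B C D : X)
    (f : hom A B) (m : hom A C) (n : hom B D) (g : hom C D) : Prop :=
  commutes f m n g /\
  forall (Z : X) (h : hom B Z) (k : hom C Z), commutes f m h k ->
    exists! u : hom D Z, u ∘ n = h /\ u ∘ g = k.

Definition has_pullbacks : Prop :=
  forall (B C D : X) (n : hom B D) (g : hom C D),
    exists (A : X) (f : hom A B) (m : hom A C), is_pullback f m n g.

(* Bottom face  g m n f , top face  g' m' n' f' , vertical arrows a, b, c, d. *)
Definition is_cube (A B C D A' B' C' D' : X)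
    (g : hom A B) (m : hom A C) (n : hom B D) (f : hom C D)
    (g' : hom A' B') (m' : hom A' C') (n' : hom B' D') (f' : hom C' D')
    (a : hom A' A) (b : hom B' B) (c : hom C' C) (d : hom D' D) : Prop :=
  commutes g m n f /\ commutes g' m' n' f' /\
  commutes g' a b g /\ commutes m' a c m /\
  commutes n' b d n /\ commutes f' c d f.

Definition is_stable_pushout (A B C D : X)
    (g : hom A B) (m : hom A C) (n : hom B D) (f : hom C D) : Prop :=
  is_pushout g m n f /\
  forall (A' B' C' D' : X)
    (g' : hom A' B') (m' : hom A' C') (n' : hom B' D') (f' : hom C' D')
    (a : hom A' A) (b : hom B' B) (c : hom C' C) (d : hom D' D),
    is_cube g m n f g' m' n' f' a b c d ->
    is_pullback g' a b g -> is_pullback m' a c m ->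
    is_pullback n' b d n /\ is_pullback f' c d f ->
    is_pushout g' m' n' f'.

Definition is_van_kampen (A B C D : X)
    (g : hom A B) (m : hom A C) (n : hom B D) (f : hom C D) : Prop :=
  is_pushout g m n f /\
  forall (A' B' C' D' : X)
    (g' : hom A' B') (m' : hom A' C') (n' : hom B' D') (f' : hom C' D')
    (a : hom A' A) (b : hom B' B) (c : hom C' C) (d : hom D' D),
    is_cube g m n f g' m' n' f' a b c d ->
    is_pullback g' a b g -> is_pullback m' a c m ->
    (is_pushout g' m' n' f' <-> is_pullback n' b d n /\ is_pullback f' c d f).

End Arrows.

Section Subobjects.
Variable X : category.

Record mono_into (Y : X) : Type := MonoInto {
  mono_dom : X;
  mono_arr : hom mono_dom Y;
  mono_arrP : is_mono mono_arr
}.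

Definition mono_le (Y : X) (u v : mono_into Y) : Prop :=
  exists h : hom (mono_dom u) (mono_dom v), mono_arr v ∘ h = mono_arr u.

Definition mono_iso (Y : X) (u v : mono_into Y) : Prop :=
  exists h : hom (mono_dom u) (mono_dom v),
    is_iso h /\ mono_arr v ∘ h = mono_arr u.

(* A subobject is an isomorphism class of monomorphisms, encoded as the
   predicate of its representatives. *)
Record Sub (Y : X) : Type := MkSub {
  sub_mem : mono_into Y -> Prop;
  sub_memP : exists u : mono_into Y, sub_mem = mono_iso u
}.

Definition sub_class (Y : X) (u : mono_into Y) : Sub Y :=
  @MkSub Y (mono_iso u) (ex_intro _ u eq_refl).

Definition sub_le (Y : X) (S T : Sub Y) : Prop :=
  exists u v : mono_into Y, sub_mem S u /\ sub_mem T v /\ mono_le u v.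

(* J = S ∨ T in the poset Sub Y; the join need not exist in general. *)
Definition is_sub_join (Y : X) (S T J : Sub Y) : Prop :=
  sub_le S J /\ sub_le T J /\
  forall K : Sub Y, sub_le S K -> sub_le T K -> sub_le J K.

End Subobjects.

Section Classes.
Variable X : category.
Implicit Types A B M N : arrow_class X.

Definition contains_isos A : Prop :=
  forall (Y Z : X) (f : hom Y Z), is_iso f -> A _ _ f.

Definition closed_under_comp A : Prop :=
  forall (U Y Z : X) (g : hom Y Z) (f : hom U Y),
    A _ _ g -> A _ _ f -> A _ _ (g ∘ f).

Definition closed_under_decomp_by A B : Prop :=
  forall (U Y Z : X) (g : hom Y Z) (f : hom U Y),
    A _ _ (g ∘ f) -> B _ _ g -> A _ _ f.

Definition closed_under_decomp A : Prop := closed_under_decomp_by A A.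

Definition stable_under_pullbacks A : Prop :=
  forall (P Q R S : X) (f : hom P Q) (m : hom P R) (n : hom Q S) (g : hom R S),
    is_pullback f m n g -> A _ _ n -> A _ _ m.

Definition stable_under_pushouts A : Prop :=
  forall (P Q R S : X) (f : hom P Q) (m : hom P R) (n : hom Q S) (g : hom R S),
    is_pushout f m n g -> A _ _ m -> A _ _ n.

Record preadhesive_structure M N : Prop := PreadhesiveStructure {
  pre_M_mono : forall (Y Z : X) (m : hom Y Z), M _ _ m -> is_mono m;
  pre_M_iso : contains_isos M;
  pre_N_iso : contains_isos N;
  pre_M_comp : closed_under_comp M;
  pre_N_comp : closed_under_comp N;
  pre_M_decomp : closed_under_decomp M;
  pre_N_decomp : closed_under_decomp N;
  pre_N_M_decomp : closed_under_decomp_by N M;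
  pre_M_pullback : stable_under_pullbacks M;
  pre_N_pullback : stable_under_pullbacks N;
  pre_M_pushout : stable_under_pushouts M;
  pre_N_pushout : stable_under_pushouts N
}.

Record adhesive M N : Prop := Adhesive {
  adh_preadhesive : preadhesive_structure M N;
  adh_pullback : forall (B C D : X) (m : hom B D) (g : hom C D), M _ _ m ->
    exists (A : X) (f : hom A B) (m' : hom A C), is_pullback f m' m g;
  adh_pushout : forall (U Y Z : X) (m : hom U Y) (n : hom U Z),
    M _ _ m -> N _ _ n ->
    exists (D : X) (p : hom Z D) (q : hom Y D), is_pushout n m p q;
  adh_van_kampen : forall (U Y Z D : X)
      (m : hom U Y) (n : hom U Z) (p : hom Z D) (q : hom Y D),
    M _ _ m -> N _ _ n -> is_pushout n m p q -> is_van_kampen n m p q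
}.

Definition preadhesive_arrow N (U Y : X) (m : hom U Y) : Prop :=
  forall (Z : X) (n : hom U Z), N _ _ n ->
    exists (D : X) (p : hom Z D) (q : hom Y D),
      is_stable_pushout n m p q /\ is_pullback n m p q.

Definition adhesive_arrow N (U Y : X) (m : hom U Y) : Prop :=
  forall (U' Y' : X) (f : hom U' U) (m' : hom U' Y') (g : hom Y' Y),
    is_pullback f m' m g -> preadhesive_arrow N m'.

Definition is_union M N (Y : X) (u : mono_into Y) : Prop :=
  exists m n : mono_into Y,
    M _ _ (mono_arr m) /\ (M _ _ (mono_arr n) /\ N _ _ (mono_arr n)) /\
    is_sub_join (sub_class m) (sub_class n) (sub_class u).

Definition closed_under_unions M N : Prop :=
  forall (Y : X) (u : mono_into Y), is_union M N u -> M _ _ (mono_arr u).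

End Classes.

(* Main.v *)
From Corelib Require Import ssreflect ssrfun.
Require Import Defs.

(** Since the arrows of [M] are [N]-adhesive, every [M],[N]-pushout is stable and a
    pullback. Consider a cube with [M],[N]-pushouts as top and bottom faces and pullbacks
    as back faces, and compare each front face with the pullback it should be. For the
    front face containing the [M]-arrow [n] of the bottom, pulling the top face back along
    the pullback of [n] yields a pushout of an identity, whose opposite side is the
    comparison. For the other front face, stability of the bottom reduces the claim to the
    invertibility of a comparison [k] between two pushouts of the same [N]-arrow, along
    [m] and along [k ∘ m]. Pulling one pushout back along the other exhibits [k] as a
    pushout of the union of a split monomorphism and an [M]-arrow. That union is
    effective, hence in [M], so [k] is in [M]; as some pushout of [k] along an [N]-arrow
    is an identity, and such pushouts are pullbacks, [k] is invertible. *)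

Set Implicit Arguments.
Unset Strict Implicit.
Unset Printing Implicit Defensive.

Local Open Scope cat_scope.

(** * Rewriting composites modulo associativity *)

Lemma comp2_eq_pre (X : category) (B C D : X) (f : hom C D) (g : hom B C) (x : hom B D) :
  f ∘ g = x -> forall (A : X) (z : hom A B), f ∘ (g ∘ z) = x ∘ z.
Proof. by move=> <- A z; rewrite comp_assoc. Qed.

Lemma comp3_eq_pre (X : category) (B C D E : X)
    (f : hom D E) (g : hom C D) (h : hom B C) (x : hom B E) :
  f ∘ (g ∘ h) = x -> forall (A : X) (z : hom A B), f ∘ (g ∘ (h ∘ z)) = x ∘ z.
Proof. by move=> <- A z; rewrite !comp_assoc. Qed.

Ltac assoc := rewrite -?comp_assoc.

(* Rewriting with an equation of composites, modulo associativity. *)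
Ltac rw e :=
  assoc; let H := fresh in
  pose proof e as H; unfold commutes in H; rewrite -?comp_assoc in H;
  first [rewrite !H | rewrite !(comp2_eq_pre H) | rewrite !(comp3_eq_pre H)];
  clear H; assoc.

(** * Pullback and pushout squares *)

Section Squares.
Context (X : category).

Section Square.
Context (A B C D : X) (f : hom A B) (m : hom A C) (n : hom B D) (g : hom C D).

Lemma mk_pullback :
  n ∘ f = g ∘ m ->
  (forall (Z : X) (h : hom Z B) (k : hom Z C), n ∘ h = g ∘ k ->
     exists u : hom Z A, f ∘ u = h /\ m ∘ u = k) ->
  (forall (Z : X) (u v : hom Z A), f ∘ u = f ∘ v -> m ∘ u = m ∘ v -> u = v) ->
  is_pullback f m n g.
Proof.
move=> sq ex inj; split=> // Z h k /ex [u [fu mu]].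
exists u; split=> // v [fv mv]; apply: inj; congruence.
Qed.

Lemma pullback_lift (Z : X) (h : hom Z B) (k : hom Z C) :
  is_pullback f m n g -> n ∘ h = g ∘ k -> exists u, f ∘ u = h /\ m ∘ u = k.
Proof. by move=> [_ univ] /univ [u [uP _]]; exists u. Qed.

Lemma pullback_inj (Z : X) (u v : hom Z A) :
  is_pullback f m n g -> f ∘ u = f ∘ v -> m ∘ u = m ∘ v -> u = v.
Proof.
move=> [sq univ] fuv muv.
have e : commutes (f ∘ v) (m ∘ v) n g by rewrite /commutes !comp_assoc sq.
have [w [_ wuniq]] := univ _ _ _ e.
by rewrite -(wuniq u) // -(wuniq v).
Qed.

Lemma mk_pushout :
  n ∘ f = g ∘ m ->
  (forall (Z : X) (h : hom B Z) (k : hom C Z), h ∘ f = k ∘ m ->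
     exists u : hom D Z, u ∘ n = h /\ u ∘ g = k) ->
  (forall (Z : X) (u v : hom D Z), u ∘ n = v ∘ n -> u ∘ g = v ∘ g -> u = v) ->
  is_pushout f m n g.
Proof.
move=> sq ex inj; split=> // Z h k /ex [u [un ug]].
exists u; split=> // v [vn vg]; apply: inj; congruence.
Qed.

Lemma pushout_lift (Z : X) (h : hom B Z) (k : hom C Z) :
  is_pushout f m n g -> h ∘ f = k ∘ m -> exists u, u ∘ n = h /\ u ∘ g = k.
Proof. by move=> [_ univ] /univ [u [uP _]]; exists u. Qed.

Lemma pushout_inj (Z : X) (u v : hom D Z) :
  is_pushout f m n g -> u ∘ n = v ∘ n -> u ∘ g = v ∘ g -> u = v.
Proof.
move=> [sq univ] unv ugv.
have e : commutes f m (v ∘ n) (v ∘ g) by rewrite /commutes -!comp_assoc sq.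
have [w [_ wuniq]] := univ _ _ _ e.
by rewrite -(wuniq u) // -(wuniq v).
Qed.

End Square.

Lemma pullback_sym (A B C D : X)
    (f : hom A B) (m : hom A C) (n : hom B D) (g : hom C D) :
  is_pullback f m n g -> is_pullback m f g n.
Proof.
move=> pb; apply: mk_pullback; first by case: pb.
- by move=> Z h k e; have [u [? ?]] := pullback_lift pb (esym e); exists u.
- by move=> Z u v ? ?; apply: (pullback_inj pb).
Qed.

Lemma pushout_sym (A B C D : X)
    (f : hom A B) (m : hom A C) (n : hom B D) (g : hom C D) :
  is_pushout f m n g -> is_pushout m f g n.
Proof.
move=> po; apply: mk_pushout; first by case: po.
- by move=> Z h k e; have [u [? ?]] := pushout_lift po (esym e); exists u.
- by move=> Z u v ? ?; apply: (pushout_inj po).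
Qed.

Lemma pullback_id_arrow (A B : X) (m : hom A B) : is_pullback (idm A) m m (idm B).
Proof.
apply: mk_pullback; first by rewrite comp_idl comp_idr.
- by move=> Z h k; rewrite comp_idl => ?; exists h; rewrite comp_idl.
- by move=> Z u v; rewrite !comp_idl.
Qed.

Lemma pushout_id_arrow (A B : X) (m : hom A B) : is_pushout (idm A) m m (idm B).
Proof.
apply: mk_pushout; first by rewrite comp_idl comp_idr.
- by move=> Z h k; rewrite comp_idr => ?; exists k; rewrite comp_idr.
- by move=> Z u v; rewrite !comp_idr.
Qed.

Lemma mono_pullback (A B : X) (m : hom A B) :
  is_mono m -> is_pullback (idm A) (idm A) m m.
Proof.
move=> mono; apply: mk_pullback => //.
- by move=> Z h k /mono <-; exists h; rewrite comp_idl.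
- by move=> Z u v; rewrite !comp_idl.
Qed.

Lemma iso_of_pullback_id (A B D : X) (f : hom A D) (m : hom A B) (g : hom B D) :
  is_pullback f m (idm D) g -> is_iso m.
Proof.
move=> pb; have [|u [fu mu]] := pullback_lift (h := g) (k := idm B) pb.
  by rewrite comp_idl comp_idr.
exists u; split=> //; apply: (pullback_inj pb).
- by rw fu; case: pb => + _; rewrite /commutes comp_idl comp_idr.
- by rw mu; rewrite comp_idl comp_idr.
Qed.

Lemma iso_of_pushout_id (A B D : X) (f : hom A B) (n : hom B D) (g : hom A D) :
  is_pushout f (idm A) n g -> is_iso n.
Proof.
move=> po; have [|u [un ug]] := pushout_lift (h := idm B) (k := f) po.
  by rewrite comp_idl comp_idr.
exists u; split=> //; apply: (pushout_inj po).
- by rw un; rewrite comp_idl comp_idr.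
- by rw ug; rewrite comp_idl; case: po => + _; rewrite /commutes comp_idr.
Qed.

(** Cancellation half of the pasting law: a map is lifted out of the outer pushout, and uniqueness
    out of the first one shows that it is right on [D]. *)
Lemma pushout_cancel (A B C D E F : X)
    (f : hom A B) (m : hom A C) (n : hom B D) (g : hom C D)
    (f' : hom B E) (n' : hom E F) (g' : hom D F) :
  is_pushout f m n g -> is_pushout (f' ∘ f) m n' (g' ∘ g) ->
  n' ∘ f' = g' ∘ n -> is_pushout f' n n' g'.
Proof.
move=> po po' sq; have [sq1 _] := po; apply: mk_pushout => //.
- move=> Z h k e.
  have [|u [un ug]] := pushout_lift (h := h) (k := k ∘ g) po'.
    by rw e; rw sq1.
  exists u; split=> //; apply: (pushout_inj po); last by rw ug.
  by rw (esym sq); rw un.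
- move=> Z u v e1 e2; apply: (pushout_inj po') => //.
  by rw e2.
Qed.

Lemma pullback_iso (A B C D E : X)
    (f : hom A B) (m : hom A C) (n : hom B D) (g : hom C D) (i : hom E A) :
  is_pullback f m n g -> is_iso i -> is_pullback (f ∘ i) (m ∘ i) n g.
Proof.
move=> pb [j [ji ij]]; apply: mk_pullback.
- by case: pb => e _; rw e.
- move=> Z h k e; have [u [fu mu]] := pullback_lift pb e.
  by exists (j ∘ u); split; rw ij; rewrite comp_idl.
- move=> Z u v; assoc => e1 e2.
  have e := pullback_inj pb e1 e2.
  by rewrite -(comp_idl u) -(comp_idl v) -ji; assoc; rewrite e.
Qed.

Lemma pullback_mono_comp (A B C D E : X)
    (f : hom A B) (m : hom A C) (n : hom B D) (g : hom C D) (i : hom D E) :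
  is_pullback f m n g -> is_mono i -> is_pullback f m (i ∘ n) (i ∘ g).
Proof.
move=> pb mono; apply: mk_pullback.
- by case: pb => e _; rw e.
- by move=> Z h k; assoc => /mono; apply: pullback_lift.
- by move=> Z u v; apply: pullback_inj pb.
Qed.

Lemma iso_mono (A B : X) (i : hom A B) : is_iso i -> is_mono i.
Proof.
move=> [j [ji _]] Z h k e.
by rewrite -(comp_idl h) -(comp_idl k) -ji; assoc; rewrite e.
Qed.

Lemma pushout_unique (A B C D E : X) (f : hom A B) (m : hom A C)
    (n : hom B D) (g : hom C D) (n' : hom B E) (g' : hom C E) :
  is_pushout f m n g -> is_pushout f m n' g' ->
  exists i : hom D E, is_iso i /\ n' = i ∘ n /\ g' = i ∘ g.
Proof.
move=> po po'; have [sq _] := po; have [sq' _] := po'.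
have [i [i1 i2]] := pushout_lift po sq'.
have [j [j1 j2]] := pushout_lift po' sq.
exists i; split=> //; exists j; split.
- by apply: (pushout_inj po); [rw i1; rewrite j1 | rw i2; rewrite j2];
     rewrite comp_idl.
- by apply: (pushout_inj po'); [rw j1; rewrite i1 | rw j2; rewrite i2];
     rewrite comp_idl.
Qed.

Lemma pushout_iso (A B C D E : X)
    (f : hom A B) (m : hom A C) (n : hom B D) (g : hom C D) (i : hom D E) :
  is_pushout f m n g -> is_iso i -> is_pushout f m (i ∘ n) (i ∘ g).
Proof.
move=> po [j [ji ij]]; apply: mk_pushout.
- by case: po => sq _; rw sq.
- move=> Z h k e; have [u [un ug]] := pushout_lift po e.
  exists (u ∘ j); split; rw ji; rewrite comp_idl; assumption.
- move=> Z u v; rewrite !comp_assoc => e1 e2.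
  have e := pushout_inj po e1 e2.
  by rewrite -(comp_idr u) -(comp_idr v) -ij !comp_assoc e.
Qed.

(** Composing the last vertical arrow of a cube over the transported square with the inverse of [i]
    gives a cube over the original square. *)
Lemma stable_pushout_iso (A B C D E : X)
    (f : hom A B) (m : hom A C) (n : hom B D) (g : hom C D) (i : hom D E) :
  is_stable_pushout f m n g -> is_iso i ->
  is_stable_pushout f m (i ∘ n) (i ∘ g).
Proof.
move=> [po st] iso; have [j [ji ij]] := iso.
have jmono : is_mono j by apply: iso_mono; exists i.
split; first exact: pushout_iso.
move=> A' B' C' D' f' m' n' g' a b c d [_ [sq' [e1 [e2 [e3 e4]]]]] pb1 pb2 [pb3 pb4].
have jn Z (h : hom Z D) : j ∘ (i ∘ h) = h by rewrite comp_assoc ji comp_idl.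
have {}pb3 : is_pullback n' b (j ∘ d) n.
  by rewrite -(jn _ n); apply: pullback_mono_comp.
have {}pb4 : is_pullback g' c (j ∘ d) g.
  by rewrite -(jn _ g); apply: pullback_mono_comp.
apply: (st _ _ _ _ f' m' n' g' a b c (j ∘ d)) => //.
by have [? _] := po; have [? _] := pb3; have [? _] := pb4.
Qed.

End Squares.

(** * Subobjects and their joins *)

Section Subobjects.
Context (X : category) (Y : X).
Implicit Types u v w : mono_into Y.

Lemma mono_le_trans u v w : mono_le u v -> mono_le v w -> mono_le u w.
Proof. by move=> [h hu] [k kv]; exists (k ∘ h); rewrite comp_assoc kv. Qed.

Lemma mono_iso_refl u : mono_iso u u.
Proof.
exists (idm _); split; last by rewrite comp_idr.
by exists (idm _); rewrite comp_idl.
Qed.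

Lemma mono_iso_le u v : mono_iso u v -> mono_le u v /\ mono_le v u.
Proof.
move=> [h [[k [kh hk]] e]]; split; first by exists h.
by exists k; rewrite -e -comp_assoc hk comp_idr.
Qed.

Lemma sub_le_class u v : sub_le (sub_class u) (sub_class v) <-> mono_le u v.
Proof.
split=> [[u' [v' [/mono_iso_le [uu' _] [/mono_iso_le [_ v'v] le]]]]|le].
- exact: mono_le_trans uu' (mono_le_trans le v'v).
- by exists u, v; split; [|split=> //]; apply: mono_iso_refl.
Qed.

Lemma sub_le_class_mem u v (K : Sub Y) :
  sub_mem K = mono_iso v -> sub_le (sub_class u) K <-> mono_le u v.
Proof. by move=> e; have := sub_le_class u v; rewrite /sub_le /= e. Qed.

(** Every subobject has a representative, so a join of classes can be tested on factorizations
    between monos. *)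
Lemma sub_join_class u v w :
  mono_le u w -> mono_le v w ->
  (forall k, mono_le u k -> mono_le v k -> mono_le w k) ->
  is_sub_join (sub_class u) (sub_class v) (sub_class w).
Proof.
move=> uw vw least; split; [|split]; try by apply/sub_le_class.
move=> K; have [k e] := sub_memP K.
move=> /(sub_le_class_mem _ e) uk /(sub_le_class_mem _ e) vk.
by apply/(sub_le_class_mem _ e); apply: least.
Qed.

End Subobjects.

(* Stability makes the two legs of a pushout jointly epic after any pullback. *)
Lemma stable_pushout_cover (X : category) (hX : has_pullbacks X) (A B C D : X)
    (f : hom A B) (m : hom A C) (n : hom B D) (g : hom C D)
    (Z W : X) (h : hom Z D) (s t : hom Z W) :
  is_stable_pushout f m n g ->
  (forall (V : X) (z : hom V Z) (x : hom V B), h ∘ z = n ∘ x -> s ∘ z = t ∘ z) ->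
  (forall (V : X) (z : hom V Z) (x : hom V C), h ∘ z = g ∘ x -> s ∘ z = t ∘ z) ->
  s = t.
Proof.
move=> [[sq _] st] onB onC.
have [ZB [zB [b pbB]]] := hX _ _ _ h n; have [eB _] := pbB.
have [ZC [zC [c pbC]]] := hX _ _ _ h g; have [eC _] := pbC.
(* [ZA] is built as a pullback over one back face only; that the other back face is a pullback too
   is derived from the two front ones. *)
have [ZA [f' [a pbA]]] := hX _ _ _ b f; have [eA _] := pbA.
have [|m' [zm cm]] := pullback_lift (h := zB ∘ f') (k := m ∘ a) pbC.
  by rw eB; rw eA; rw sq.
suff po : is_pushout f' m' zB zC.
  by apply: (pushout_inj po); [exact: (onB _ _ _ eB) | exact: (onC _ _ _ eC)].
apply: (st _ _ _ _ f' m' zB zC a b c h) => //.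
apply: mk_pullback => //.
- move=> V x y e.
  have [|u [u1 u2]] := pullback_lift (h := zC ∘ x) (k := f ∘ y) pbB.
    by rw eC; rw e; rw (esym sq).
  have [w [w1 w2]] := pullback_lift pbA u2.
  exists w; split=> //; apply: (pullback_inj pbC).
    by rw zm; rw w1.
  by rw cm; rw w2.
- move=> V u v e1 e2; apply: (pullback_inj pbA) => //.
  apply: (pullback_inj pbB).
    by rw (esym zm); rw e1.
  by rw eA; rw e2.
Qed.

(** * Pushouts of [M]-arrows along [N]-arrows under the hypotheses of the theorem *)

Section Criterion.
Context (X : category) (M N : arrow_class X).
Context (hX : has_pullbacks X) (hMN : preadhesive_structure M N).
Context (hsplit : forall (A B : X) (m : hom A B), is_split_mono m -> M m /\ N m).
Context (hadh : forall (A B : X) (m : hom A B), M m -> adhesive_arrow N m).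
Context (hunion : closed_under_unions M N).

Lemma MN_pushout_exists (A B C : X) (m : hom A B) (n : hom A C) :
  M m -> N n -> exists (D : X) (p : hom C D) (q : hom B D),
    is_stable_pushout n m p q /\ is_pullback n m p q.
Proof. by move=> mM; apply: (hadh mM (pullback_id_arrow m)). Qed.

(** Adhesivity supplies one good pushout of each span. Any other is isomorphic to it, and both
    properties pass along the isomorphism. *)
Lemma MN_pushout_stable_pullback (A B C D : X)
    (m : hom A B) (n : hom A C) (p : hom C D) (q : hom B D) :
  M m -> N n -> is_pushout n m p q ->
  is_stable_pushout n m p q /\ is_pullback n m p q.
Proof.
move=> mM nN po; have [D0 [p0 [q0 [st pb]]]] := MN_pushout_exists mM nN.
have [i [iso [-> ->]]] := pushout_unique (proj1 st) po.
split; first exact: stable_pushout_iso.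
exact: pullback_mono_comp (iso_mono iso).
Qed.

(** Once [u] is monic, the universal property of [P] makes it least among the subobjects above [a]
    and [b], so closure under unions applies. *)
Lemma effective_union (I A B P E : X) (n : hom I B) (m : hom I A)
    (p : hom B P) (q : hom A P) (b : hom B E) (a : hom A E) (u : hom P E) :
  M a -> M b -> N b ->
  is_pullback n m b a -> is_pushout n m p q -> u ∘ p = b -> u ∘ q = a ->
  M u.
Proof.
move=> aM bM bN pbI po up uq.
have amono := pre_M_mono hMN aM; have bmono := pre_M_mono hMN bM.
have mM : M m := pre_M_pullback hMN pbI bM.
have mN : N m := pre_N_pullback hMN pbI bN.
have nM : M n := pre_M_pullback hMN (pullback_sym pbI) aM.
have [st _] := MN_pushout_stable_pullback nM mN (pushout_sym po).
have meet (V : X) (x : hom V A) (y : hom V B) : a ∘ x = b ∘ y -> q ∘ x = p ∘ y.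
  move=> e; have [i [<- <-]] := pullback_lift pbI (esym e).
  by case: po => sq _; rw (esym sq).
(* Locally on [Z], each of [h] and [k] factors through [q] or [p]. When both use the same leg,
   monicity of [a] or [b] concludes; the mixed cases are [meet]. *)
have umono : is_mono u.
  move=> Z h k e; apply: (stable_pushout_cover hX (h := h) st) => V z x hx.
    apply: (stable_pushout_cover hX (h := k ∘ z) st) => W w y; assoc => ky.
      rw hx; rewrite ky; congr (_ ∘ _); apply: amono.
      by rewrite -uq; assoc; rewrite -ky; rw (esym hx); rw e.
    rw hx; rewrite ky; apply: meet.
    by rewrite -uq -up; assoc; rewrite -ky; rw (esym hx); rw e.
  apply: (stable_pushout_cover hX (h := k ∘ z) st) => W w y; assoc => ky.
    rw hx; rewrite ky; apply/esym/meet.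
    by rewrite -uq -up; assoc; rewrite -ky; rw (esym hx); rw e.
  rw hx; rewrite ky; congr (_ ∘ _); apply: bmono.
  by rewrite -up; assoc; rewrite -ky; rw (esym hx); rw e.
apply: (hunion (u := MonoInto umono)).
exists (MonoInto amono), (MonoInto bmono); split=> //; split=> //.
apply: sub_join_class; [by exists q | by exists p |].
move=> [K k kmono] [/= ha ea] [/= hb eb].
have [|v [vp vq]] := pushout_lift (h := hb) (k := ha) po.
  by apply: kmono; rw eb; rw ea; case: pbI.
exists v => /=; apply: (pushout_inj po).
  by rw vp; rewrite eb.
by rw vq; rewrite ea.
Qed.

(** Decomposition says nothing about [k], the outer factor of [k ∘ m]. Its membership in [M] is
    obtained by exhibiting it as a pushout, starting from the kernel pair of [g]. *)
Lemma pushout_comparison_iso (A B C C2 D : X) (g : hom A B) (m : hom A C)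
    (n : hom B D) (f : hom C D) (k : hom C C2) (f2 : hom C2 D) :
  N g -> M m -> M (k ∘ m) -> f2 ∘ k = f ->
  is_pushout g m n f -> is_pushout g (k ∘ m) n f2 -> is_iso k.
Proof.
move=> gN mM kmM fk po po2.
have [st _] := MN_pushout_stable_pullback mM gN po.
have [_ pb2] := MN_pushout_stable_pullback kmM gN po2.
have fN : N f := pre_N_pushout hMN (pushout_sym po) gN.
have [sq _] := po; have [sq2 _] := po2.
have kmmono := pre_M_mono hMN kmM.
have [E [e1 [e2 pbE]]] := hX f f2; have [sqE _] := pbE.
have [R [r1 [r2 pbR]]] := hX g g; have [sqR _] := pbR.
(* The projections are crossed: [e1 ∘ j] uses [r2] and [e2 ∘ j] uses [r1]. Below, [s] is the graph
   of [k], a section of [e1]. *)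
have [|j [e1j e2j]] := pullback_lift (h := m ∘ r2) (k := (k ∘ m) ∘ r1) pbE.
  by rw (esym sq); rw (esym sq2); rw sqR.
have [|s [e1s e2s]] := pullback_lift (h := idm C) (k := k) pbE.
  by rewrite comp_idr.
have [|dg [r1d r2d]] := pullback_lift (h := idm A) (k := idm A) pbR => //.
have pbj : is_pullback j r2 e1 m.
{ apply: mk_pullback => // [Z h l e|Z u v ju r2u].
  - have [|w [gw mw]] := pullback_lift (h := g ∘ l) (k := e2 ∘ h) pb2.
      by rw sq; rw (esym e); rw sqE.
    have [u [r1u r2u]] := pullback_lift pbR gw.
    exists u; split=> //; apply: (pullback_inj pbE).
      by rw e1j; rewrite r2u e.
    by rw e2j; rewrite r1u; rw mw.
  - apply: (pullback_inj pbR) => //; apply: kmmono.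
    by rw (esym e2j); rewrite ju. }
(* This is [po] pulled back along [f2]; [pb2] is one of the front faces. *)
have poE : is_pushout r1 j (k ∘ m) e2.
  apply: (proj2 st _ _ _ _ r1 j (k ∘ m) e2 r2 g e1 f2) => //.
  by split; apply: pullback_sym.
(* The graph [s] meets [j] exactly in the diagonal [dg]. *)
have pbI : is_pullback m dg s j.
{ apply: mk_pullback.
  - apply: (pullback_inj pbE); first by rw e1s; rw e1j; rewrite r2d comp_idl comp_idr.
    by rw e2s; rw e2j; rewrite r1d comp_idr.
  - move=> Z h l e.
    have hl : h = m ∘ (r2 ∘ l).
      by rewrite comp_assoc -e1j; assoc; rewrite -e; rw e1s; rewrite comp_idl.
    exists (r2 ∘ l); split=> //; apply: (pullback_inj pbR).
      apply/esym/kmmono; rw r1d; rewrite comp_idl.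
      by rw (esym e2j); rewrite -e; rw e2s; rewrite hl.
    by rw r2d; rewrite comp_idl.
  - by move=> Z x y _ e; rewrite -(comp_idl x) -(comp_idl y) -r1d; assoc; rewrite e. }
have [_ dN] : M dg /\ N dg by apply: hsplit; exists r1.
have [sM sN] : M s /\ N s by apply: hsplit; exists e1.
(* [P] is the union of [j] and [s] inside [E], included by [u]. The map [v] collapses it onto [C],
   retracting [q]. *)
have [P [p [q [[poP _] _]]]] := MN_pushout_exists mM dN.
have [|u [up uq]] := pushout_lift (h := j) (k := s) poP; first by case: pbI.
have [|v [vp vq]] := pushout_lift (h := m ∘ r1) (k := idm C) poP.
  by rw r1d; rewrite comp_idl comp_idr.
have jM : M j := pre_M_pullback hMN (pullback_sym pbj) mM.
have uM : M u := effective_union jM sM sN pbI (pushout_sym poP) uq up.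
(* Since [r1] retracts [dg], pasting with [poP] gives the trivial pushout of [m] along an
   identity. *)
have poV : is_pushout r1 p m v.
  apply: (pushout_cancel poP) => //.
  by rewrite r1d vq; apply: pushout_id_arrow.
(* As [u ∘ p = j], cancelling [poV] from [poE] leaves this square. *)
have poK : is_pushout v u k e2.
  apply/pushout_sym/(pushout_cancel (pushout_sym poV)).
    by rewrite up; apply: pushout_sym.
  apply: (pushout_inj poP).
    by rw up; rw vp; rewrite e2j; assoc.
  by rw uq; rw vq; rewrite e2s comp_idr.
have kM : M k := pre_M_pushout hMN poK uM.
have poD : is_pushout f k (idm D) f2.
  apply/pushout_sym/(pushout_cancel (pushout_sym po)).
    by rewrite comp_idl; apply: pushout_sym.
  by rewrite comp_idl.
have [_ pbD] := MN_pushout_stable_pullback kM fN poD.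
exact: iso_of_pullback_id pbD.
Qed.

Lemma MN_pushout_van_kampen (A B C D : X)
    (m : hom A C) (g : hom A B) (n : hom B D) (f : hom C D) :
  M m -> N g -> is_pushout g m n f -> is_van_kampen g m n f.
Proof.
move=> mM gN po; have [st pb] := MN_pushout_stable_pullback mM gN po.
split=> // A' B' C' D' g' m' n' f' a b c d cube pbg pbm.
split; last by case: st => _ st; apply: st cube pbg pbm.
move=> po'; have [sq [sq' [sqg [sqm [sqn sqf]]]]] := cube.
have m'M : M m' := pre_M_pullback hMN (pullback_sym pbm) mM.
have g'N : N g' := pre_N_pullback hMN (pullback_sym pbg) gN.
have [st' pb'] := MN_pushout_stable_pullback m'M g'N po'.
have m'mono := pre_M_mono hMN m'M.
have nM : M n := pre_M_pushout hMN po mM.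
have n'mono := pre_M_mono hMN (pre_M_pushout hMN po' m'M).
have pbB : is_pullback n' b d n.
{ have [B2 [n2 [b2 pbB2]]] := hX d n; have [sqB2 _] := pbB2.
  have n2mono := pre_M_mono hMN (pre_M_pullback hMN (pullback_sym pbB2) nM).
  have [k [n2k b2k]] := pullback_lift pbB2 sqn.
  (* The top face is pulled back along [n2]. Over [n'] this gives [B'], as [n2] is monic; over [f']
     it gives [A'], as the bottom face and the back face on [m] are pullbacks. *)
  have po2 : is_pushout g' (idm A') k (k ∘ g').
  { apply: (proj2 st' _ _ _ _ g' (idm A') k (k ∘ g') (idm A') (idm B') m' n2).
    - rewrite /is_cube /commutes ?comp_idl ?comp_idr; do !split=> //.
      by rw n2k.
    - exact/pullback_sym/pullback_id_arrow.
    - exact: mono_pullback.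
    - split; apply: mk_pullback.
      + by rewrite comp_idr.
      + move=> Z x y e; exists y; rewrite comp_idl; split=> //.
        by apply: n2mono; rw n2k.
      + by move=> Z x y _; rewrite !comp_idl.
      + by rw n2k.
      + move=> Z x y e.
        have [|w [gw mw]] := pullback_lift (h := b2 ∘ x) (k := c ∘ y) pb.
          by rw (esym sqB2); rw (esym sqf); rw e.
        have [w' [m'w aw]] := pullback_lift pbm (esym mw).
        exists w'; split=> //; apply: n2mono.
        by rw n2k; rewrite e -m'w; rw sq'.
      + by move=> Z x y _; apply: m'mono. }
  have kiso := iso_of_pushout_id po2.
  by rewrite -n2k -b2k; apply: pullback_iso. }
split=> //.
have [C2 [f2 [c2 pbC2]]] := hX d f; have [sqC2 _] := pbC2.
have [k [f2k c2k]] := pullback_lift pbC2 sqf.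
(* The front face [pbB], already settled, provides the component in [B'] from which the lift to [A']
   is made. *)
have pbkm : is_pullback (k ∘ m') a c2 m.
{ apply: mk_pullback; first by rw c2k.
  - move=> Z x y e.
    have [|z [nz bz]] := pullback_lift (h := f2 ∘ x) (k := g ∘ y) pbB.
      by rw sqC2; rw e; rw sq.
    have [w [gw aw]] := pullback_lift pbg bz.
    exists w; split=> //; apply: (pullback_inj pbC2).
      by rw f2k; rw (esym sq'); rewrite gw.
    by rw c2k; rw sqm; rewrite aw.
  - move=> Z x y e1 e2; apply: (pullback_inj pbg) => //.
    by apply: n'mono; rw sq'; rw (esym f2k); move: e1; assoc => ->. }
have km'M : M (k ∘ m') := pre_M_pullback hMN (pullback_sym pbkm) mM.
have kiso : is_iso k.
{ apply: (pushout_comparison_iso g'N m'M km'M f2k po').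
  (* Replacing [C'] by [C2] in the cube makes both front faces pullbacks, so the new top face is a
     pushout of [g'] and [k ∘ m']. *)
  apply: (proj2 st _ _ _ _ g' (k ∘ m') n' f2 a b c2 d) => //.
  have [sqkm _] := pbkm; rewrite /is_cube; do !split=> //.
  by rewrite /commutes; rw f2k. }
by rewrite -f2k -c2k; apply: pullback_iso.
Qed.

End Criterion.

Theorem theorem4p5 (X : category) (M N : arrow_class X)
  (hX : has_pullbacks X)
  (hMN : preadhesive_structure M N)
  (hsplit : forall (A B : X) (m : hom A B), is_split_mono m -> M A B m /\ N A B m)
  (hadh : forall (A B : X) (m : hom A B), M A B m -> adhesive_arrow N m)
  (hunion : closed_under_unions M N) :
  adhesive M N.
Proof.
split=> //.
- move=> U Y Z m n mM nN.
  have [D [p [q [[po _] _]]]] := MN_pushout_exists hadh mM nN.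
  by exists D, p, q.
- by move=> U Y Z D m n p q; apply: MN_pushout_van_kampen.
Qed.
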